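(* For every integer $n\ge 0$, $$T_{n+2}=\sum_{k=1}^{n}P_{k+2}T_{n-k+2}+P_{n+3},$$ where $T_j$ are the tribonacci numbers and $P_j$ the Padovan numbers.
   Context: Tribonacci numbers: $T_0=T_1=0$, $T_2=1$, $T_n=T_{n-1}+T_{n-2}+T_{n-3}$ for $n\ge3$. Padovan sequence: $P_0=1$, $P_1=P_2=0$, $P_n=P_{n-2}+P_{n-3}$ for $n\ge3$. *)

(* Defs.v *)
From mathcomp Require Import all_boot.

Fixpoint tribonacci (n : nat) : nat :=
  match n with
  | 0 | 1 => 0
  | 2 => 1
  | ((m.+1 as m1).+1 as m2).+1 => tribonacci m2 + tribonacci m1 + tribonacci m
  end.

Fixpoint padovan (n : nat) : nat :=
  match n with
  | 0 => 1
  | 1 | 2 => 0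
  | ((m.+1 as m1).+1).+1 => padovan m1 + padovan m
  end.

(* Main.v *)
Require Import Defs.
From mathcomp Require Import all_boot zify.

(** With p_j = P_{j+3} and t_j = T_{j+2}, the sum is the convolution
    S_n = \sum_(j < n) p_j t_{n-1-j}. The Padovan recurrence applied to the
    p_j gives S_{n+3} = t_{n+2} + S_{n+1} + S_n, so S_n + p_n satisfies the
    tribonacci recurrence. Equivalently, t = p + x p t for the generating
    functions t = 1/(1-x-x^2-x^3) and p = 1/(1-x^2-x^3). *)

Arguments tribonacci : simpl never.
Arguments padovan : simpl never.

Definition padovan_tribonacci_conv (n : nat) : nat :=
  \sum_(j < n) padovan j.+3 * tribonacci (n - j.+1).+2.

Lemma tribonacciS3 n :
  tribonacci n.+3 = tribonacci n.+2 + tribonacci n.+1 + tribonacci n.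
Proof. by []. Qed.

Lemma padovanS3 n : padovan n.+3 = padovan n.+1 + padovan n.
Proof. by []. Qed.

Lemma padovan_tribonacci_convS3 n :
  padovan_tribonacci_conv n.+3 =
    tribonacci n.+4 + padovan_tribonacci_conv n.+1 + padovan_tribonacci_conv n.
Proof.
(* Splitting off j = 0 leaves the coefficients p_{j+1}, as in p_{j+3} = p_{j+1} + p_j. *)
have conv1 : padovan_tribonacci_conv n.+1 = tribonacci n.+2 +
    \sum_(j < n) padovan j.+4 * tribonacci (n - j.+1).+2.
  by rewrite /padovan_tribonacci_conv big_ord_recl /= subn1 mul1n.
have conv0 : \sum_(j < n) padovan j.+3.+3 * tribonacci (n - j.+1).+2 =
    \sum_(j < n) padovan j.+4 * tribonacci (n - j.+1).+2
    + padovan_tribonacci_conv n.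
  by rewrite -big_split; apply: eq_bigr => j _; rewrite padovanS3 mulnDl.
(* The three leading coefficients are p_0 = 1, p_1 = 0, p_2 = 1; the p_2 term is the head of
   [conv1]. *)
rewrite {}conv1 {1}/padovan_tribonacci_conv !big_ord_recl /= /bump /=.
rewrite !subSS !subn0 -[padovan 3]/1 -[padovan 4]/0 -[padovan 5]/1.
under eq_bigr do rewrite !add1n !subSS.
rewrite {}conv0; move: (\sum_(j < n) _) => s; lia.
Qed.

Lemma tribonacci_conv n :
  tribonacci n.+2 = padovan_tribonacci_conv n + padovan n.+3.
Proof.
have [m] := ubnP n; elim: m n => // m IHm [|[|[|n]]] ltnm.
- by rewrite /padovan_tribonacci_conv big_ord0.
- by rewrite /padovan_tribonacci_conv big_ord1.
- by rewrite /padovan_tribonacci_conv !big_ord_recl big_ord0.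
(* [tribonacci n.+4] now stands on both sides; the rest is the sum of the cases [n.+1] and [n]. *)
rewrite padovan_tribonacci_convS3 tribonacciS3 (padovanS3 n.+3).
by rewrite (IHm n.+1) ?(IHm n); lia.
Qed.

Theorem theorem17 (n : nat) :
  tribonacci (n + 2) =
    \sum_(1 <= k < n.+1) padovan (k + 2) * tribonacci (n - k + 2)
    + padovan (n + 3).
Proof.
(* Reindex by k = j + 1. *)
rewrite addn2 addn3 tribonacci_conv big_add1 big_mkord; congr (_ + _).
by apply: eq_bigr => j _; rewrite !addn2.
Qed.
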